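(* Let $d_{w,1}$ be a Lorentz sequence space (with $p=1$) and let $T\in L(d_{w,1})$. Then $T$ is weakly compact if and only if $T$ is strictly singular.
   Context: Let $w=(w_n)$ be a real sequence with $w_1=1$, $w_n\downarrow 0$ and $\sum_n w_n=\infty$. The Lorentz sequence space $d_{w,1}$ is the Banach space of all $x=(x_n)\in c_0$ with $\|x\|=\sum_{n}w_n x^*_n<\infty$, where $(x^*_n)$ is the non-increasing rearrangement of $(|x_n|)$. An operator is strictly singular if its restriction to no infinite-dimensional closed subspace is an isomorphism; it is weakly compact if it maps the unit ball to a relatively weakly compact set. *)

(* Defs.v *)
From HB Require Import structures.
From mathcomp Require Import all_boot all_order all_algebra.
From mathcomp Require Import all_classical all_reals all_analysis.
Set Implicit Arguments. Unset Strict Implicit. Unset Printing Implicit Defensive.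
Import Order.TTheory GRing.Theory Num.Theory.
Import numFieldNormedType.Exports.
Local Open Scope classical_set_scope.
Local Open Scope ring_scope.

Section Lorentz.
Variables (R : realType) (w : nat -> R).

(** Non-increasing rearrangement (0-indexed: [xstar x 0] is the largest |x_k|):
    x*_n = inf { t >= 0 | #{k : |x_k| > t} <= n }. *)
Definition xstar (x : nat -> R) (n : nat) : R :=
  inf [set t : R | 0 <= t /\
       forall s : seq nat, uniq s -> all (fun k => t < `|x k|) s ->
       (size s <= n)%N].

Definition lnorm (x : nat -> R) : \bar R :=
  (\sum_(0 <= n <oo) (w n * xstar x n)%:E)%E.

Definition in_d (x : nat -> R) : Prop :=
  x @ \oo --> (0 : R) /\ (lnorm x < +oo)%E.

Definition unit_ball : set (nat -> R) :=
  [set x | in_d x /\ (lnorm x <= 1)%E].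

Definition bounded_op (T : (nat -> R) -> (nat -> R)) : Prop :=
  [/\ forall x, in_d x -> in_d (T x),
      forall (a : R) x y, in_d x -> in_d y ->
        T (fun k => a * x k + y k) = (fun k => a * T x k + T y k)
    & exists C : R, forall x, in_d x -> (lnorm (T x) <= C%:E * lnorm x)%E].

Definition is_dual (f : (nat -> R) -> R) : Prop :=
  (forall (a : R) x y, in_d x -> in_d y ->
     f (fun k => a * x k + y k) = a * f x + f y)
  /\ exists C : R, forall x, in_d x -> (`|f x|%:E <= C%:E * lnorm x)%E.

Definition dualT := {f : (nat -> R) -> R | is_dual f}.

Definition ev (x : nat -> R) : prod_topology (fun _ : dualT => R) := fun f => proj1_sig f x.

Definition weakT := initial_topology ev.
Definition weak_d := @subspace weakT in_d.

Definition rel_weakly_compact (A : set (nat -> R)) : Prop :=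
  @compact weak_d (@closure weak_d A).

Definition weakly_compact (T : (nat -> R) -> (nat -> R)) : Prop :=
  rel_weakly_compact (T @` unit_ball).

Definition closed_subspace (Y : set (nat -> R)) : Prop :=
  [/\ Y `<=` in_d, Y (fun _ => 0),
      forall (a : R) x y, Y x -> Y y -> Y (fun k => a * x k + y k)
    & forall (u : nat -> nat -> R) (x : nat -> R), (forall n, Y (u n)) ->
        in_d x -> (fun n => lnorm (fun k => u n k - x k)) @ \oo --> 0%E ->
        Y x].

Definition infinite_dim (Y : set (nat -> R)) : Prop :=
  forall s : seq (nat -> R), exists2 y, Y y &
    forall c : nat -> R,
      y <> (fun k => \sum_(i < size s) c i * nth (fun _ => 0) s i k).

Definition iso_on (T : (nat -> R) -> (nat -> R)) (Y : set (nat -> R)) : Prop :=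
  exists2 c : R, 0 < c & forall y, Y y -> (c%:E * lnorm y <= lnorm (T y))%E.

Definition strictly_singular (T : (nat -> R) -> (nat -> R)) : Prop :=
  forall Y, closed_subspace Y -> infinite_dim Y -> ~ iso_on T Y.

End Lorentz.

(* Main.v *)
(**
The norm of a null sequence x is the supremum of sum_i w_i |x(s_i)| over finite
lists s of distinct indices, so the norm is monotone in |x|.

Weakly compact => strictly singular.  Let T be bounded below by c > 0 on an
infinite-dimensional Y.  Sums of many disjointly peaked vectors have bounded
coordinates but norm at least sum_(i<n) w_i -> oo, so T(Y) contains unit vectors
z_n vanishing on longer and longer initial segments and as flat as desired.
Flatness allows the norming list of z_n to be shifted beyond the earlier ones at
little cost, so one functional g(x) = sum_i w_i x(tau_i), with tau the
concatenation of these lists, satisfies g(z_n) >= 1/8 for all n.  Since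
z_n -> 0 coordinatewise, c z_n has no weak cluster point, although it lies in the
image of the unit ball.

Strictly singular => weakly compact.  An ultrafilter on the weak closure of the
image of the ball has a coordinatewise limit y, which lies in d_{w,1}.  If it does
not converge weakly to y, some functional f and some x_n in the ball satisfy
|f(T x_n - y)| >= d with T x_n - y nearly a block sequence.  Changing signs of
disjoint blocks does not change the norm, so f forces a lower l^1 estimate on
T x_n - y, and T is bounded below on the closed span of x_(n+1) - x_0.
*)
Require Import Defs.
From HB Require Import structures.
From mathcomp Require Import all_boot all_order all_algebra.
From mathcomp Require Import all_classical all_reals all_analysis.
From mathcomp Require Import ring lra zify.
Import Order.TTheory GRing.Theory Num.Theory.
Import numFieldNormedType.Exports.
Local Open Scope classical_set_scope.
Local Open Scope ring_scope.

Section LorentzSpace.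
Set Implicit Arguments.
Unset Strict Implicit.
Variables (R : realType) (w : nat -> R).
Hypothesis w0 : w 0%N = 1.
Hypothesis w_dec : forall n, w n.+1 <= w n.
Hypothesis w_lim : w @ \oo --> (0 : R).
Hypothesis w_sum : (\sum_(0 <= n <oo) (w n)%:E = +oo)%E.

Implicit Types (x y z : nat -> R) (s t : seq nat).

(** * The weights *)

Lemma weight_ge0 n : 0 <= w n.
Proof.
have nw : nonincreasing_seq w by apply/nonincreasing_seqP.
have := nonincreasing_cvgn_ge nw (cvgP _ w_lim) n.
by rewrite (cvg_lim _ w_lim).
Qed.

Lemma weight_le m n : (m <= n)%N -> w n <= w m.
Proof. by move: m n; apply/nonincreasing_seqP. Qed.

Lemma weight_le1 n : w n <= 1.
Proof. by rewrite -w0; apply: weight_le. Qed.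

Lemma weight_sum_unbounded (M : R) : exists n, M <= \sum_(0 <= i < n) w i.
Proof.
apply: contrapT => /forallNP H.
suff: (\sum_(0 <= n <oo) (w n)%:E <= M%:E)%E by rewrite w_sum.
apply: lime_le.
  by apply: is_cvg_nneseries => n _ _; rewrite lee_fin weight_ge0.
apply: nearW => n; rewrite sumEFin lee_fin.
by have /negP := H n; rewrite -ltNge => /ltW.
Qed.

(** * The norm as a supremum of finite weighted sums *)

(* The offset [L] shifts the weights: the list [s] is charged to the positions
   [L], [L+1], and so on. *)
Fixpoint wsum (L : nat) s x : R :=
  if s is k :: s' then w L * `|x k| + wsum L.+1 s' x else 0.

Lemma wsumE L s x :
  wsum L s x = \sum_(i < size s) w (L + i)%N * `|x (nth 0%N s i)|.
Proof.
elim: s L => [|k s IH] L /=; first by rewrite big_ord0.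
rewrite big_ord_recl /= addn0; congr (_ + _).
by rewrite IH; apply: eq_bigr => i _; rewrite addSnnS.
Qed.

Lemma wsum_ge0 L s x : 0 <= wsum L s x.
Proof. by elim: s L => //= k s IH L; rewrite addr_ge0 ?mulr_ge0 ?weight_ge0. Qed.

Lemma wsum_cat L s t x : wsum L (s ++ t) x = wsum L s x + wsum (L + size s) t x.
Proof.
elim: s L => [|k s IH] L /=; first by rewrite add0r addn0.
by rewrite IH addrA addSnnS.
Qed.

Lemma wsum_le L s x y : {in s, forall k, `|x k| <= `|y k|} ->
  wsum L s x <= wsum L s y.
Proof.
elim: s L => //= k s IH L H; apply: lerD.
  by rewrite ler_wpM2l ?weight_ge0// H ?mem_head.
by apply: IH => j js; rewrite H// inE js orbT.
Qed.

Lemma wsumS L s x : wsum L.+1 s x <= wsum L s x.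
Proof.
elim: s L => //= k s IH L; apply: lerD; last exact: IH.
by rewrite ler_wpM2r.
Qed.

Lemma wsum_shift_le L n s x : wsum (L + n) s x <= wsum L s x.
Proof.
elim: n => [|n IH]; first by rewrite addn0.
by rewrite addnS (le_trans (wsumS _ _ _)).
Qed.

Lemma wsumD L s x y a :
  wsum L s (fun k => a * x k + y k) <= `|a| * wsum L s x + wsum L s y.
Proof.
elim: s L => [|k s IH] L /=; first by rewrite mulr0 addr0.
rewrite mulrDr addrACA lerD// mulrCA -mulrDr ler_wpM2l ?weight_ge0//.
by rewrite -normrM ler_normD.
Qed.

(** In each of the two sublists an entry moves to an earlier position, where its weight is no
    smaller. *)
Lemma wsum_filter L s x (p : pred nat) :
  wsum L s x <= wsum L [seq k <- s | p k] x + wsum L [seq k <- s | ~~ p k] x.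
Proof.
elim: s L => [|k s IH] L /=; first by rewrite addr0.
case: (p k) => /=.
  by rewrite -addrA lerD2l (le_trans (IH _))// lerD2l wsumS.
by rewrite addrCA lerD2l (le_trans (IH _))// lerD2r wsumS.
Qed.

(** The loss is a sum of terms [(w i - w i.+1) * |x k|], which telescopes to at most [e * w L]. *)
Lemma wsum_shift1 L s x (e : R) : 0 <= e -> {in s, forall k, `|x k| <= e} ->
  wsum L s x <= wsum L.+1 s x + e * w L.
Proof.
move=> e0; elim: s L => [|k s IH] L H /=.
  by rewrite add0r mulr_ge0 ?weight_ge0.
have H1 : wsum L.+1 s x <= wsum L.+2 s x + e * w L.+1.
  by apply: IH => j js; rewrite H// inE js orbT.
have H2 : (w L - w L.+1) * `|x k| <= (w L - w L.+1) * e.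
  by rewrite ler_wpM2l ?subr_ge0 ?w_dec// H ?mem_head.
by rewrite !mulrBl in H2; lra.
Qed.

Lemma wsum_shift n L s x (e : R) : 0 <= e -> {in s, forall k, `|x k| <= e} ->
  wsum L s x <= wsum (L + n) s x + n%:R * e.
Proof.
move=> e0 H; elim: n => [|n IH]; first by rewrite addn0 mul0r addr0.
have := @wsum_shift1 (L + n) s x e e0 H; rewrite addnS => H1.
have : e * w (L + n)%N <= e by rewrite -[leRHS]mulr1 ler_wpM2l ?weight_le1.
by rewrite -natr1 mulrDl mul1r; lra.
Qed.

Lemma wsum_ge_const L s x (e : R) : {in s, forall k, e <= `|x k|} ->
  e * \sum_(0 <= i < size s) w (L + i)%N <= wsum L s x.
Proof.
rewrite wsumE mulr_sumr big_mkord => H; apply: ler_sum => i _.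
by rewrite mulrC ler_wpM2l ?weight_ge0// H// mem_nth.
Qed.

Lemma wsum_le_const s x (e : R) : 0 <= e -> {in s, forall k, `|x k| <= e} ->
  wsum 0 s x <= (size s)%:R * e.
Proof.
move=> e0 H; rewrite wsumE -[in leRHS](card_ord (size s)) mulr_natl -sumr_const.
apply: ler_sum => i _; rewrite -[leRHS]mul1r.
by apply: ler_pM; rewrite ?weight_ge0 ?weight_le1 ?H ?mem_nth.
Qed.

Lemma weighted_sum_le (a b : nat -> R) n :
  (forall m, (m <= n)%N -> \sum_(i < m) a i <= \sum_(i < m) b i) ->
  \sum_(i < n) w i * a i <= \sum_(i < n) w i * b i.
Proof.
move=> H; rewrite -subr_ge0 -sumrB.
(* The left side is the boundary term of Abel summation. It is nonnegative, and keeping it makes the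
   induction close. *)
suff : w n * (\sum_(i < n) b i - \sum_(i < n) a i)
      <= \sum_(i < n) (w i * b i - w i * a i).
  by apply: le_trans; rewrite mulr_ge0 ?weight_ge0// subr_ge0 H.
elim: n H => [|n IH] H; first by rewrite !big_ord0 subrr mulr0.
rewrite !big_ord_recr /=.
have /IH H1 : forall m, (m <= n)%N -> \sum_(i < m) a i <= \sum_(i < m) b i.
  by move=> m mn; apply: H; apply: leqW.
have H2 := H n.+1 (leqnn _); rewrite !big_ord_recr /= in H2.
set A := \sum_(i < n) a i in H1 H2 *; set B := \sum_(i < n) b i in H1 H2 *.
have : (w n - w n.+1) * (B + b n - (A + a n)) >= 0.
  by rewrite mulr_ge0 ?subr_ge0 ?w_dec.
set W := \sum_(i < n) _ in H1 *.
by nra.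
Qed.

(** The signed counterpart of [wsum]: being linear in [x], it can serve to build functionals. *)
Fixpoint vsum (L : nat) s x : R :=
  if s is k :: s' then w L * x k + vsum L.+1 s' x else 0.

Lemma vsum_cat L s t x : vsum L (s ++ t) x = vsum L s x + vsum (L + size s) t x.
Proof.
elim: s L => [|k s IH] L /=; first by rewrite add0r addn0.
by rewrite IH addrA addSnnS.
Qed.

Lemma vsum_lin L s a x y :
  vsum L s (fun k => a * x k + y k) = a * vsum L s x + vsum L s y.
Proof.
elim: s L => [|k s IH] L /=; first by rewrite mulr0 addr0.
by rewrite IH; ring.
Qed.

Lemma norm_vsum L s x : `|vsum L s x| <= wsum L s x.
Proof.
elim: s L => [|k s IH] L /=; first by rewrite normr0.
by rewrite (le_trans (ler_normD _ _))// lerD// normrM ger0_norm ?weight_ge0.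
Qed.

Lemma vsum0 L s x : {in s, forall k, x k = 0} -> vsum L s x = 0.
Proof.
elim: s L => //= k s IH L H; rewrite H ?mem_head// mulr0 add0r IH// => j js.
by rewrite H// inE js orbT.
Qed.

Lemma vsum_wsum L s x : {in s, forall k, 0 < x k} -> vsum L s x = wsum L s x.
Proof.
elim: s L => //= k s IH L H; rewrite gtr0_norm ?H ?mem_head// IH// => j js.
by rewrite H// inE js orbT.
Qed.

(** * Null sequences and their non-increasing rearrangement *)

Lemma c0_small x : x @ \oo --> (0 : R) -> forall e, 0 < e ->
  exists N, forall k, (N <= k)%N -> `|x k| <= e.
Proof.
move=> /cvgrPdist_le H e /H [N _ HN]; exists N => k Nk.
by have := HN k Nk; rewrite /= sub0r normrN.
Qed.

Lemma small_c0 x :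
  (forall e, 0 < e -> exists N, forall k, (N <= k)%N -> `|x k| <= e) ->
  x @ \oo --> (0 : R).
Proof.
move=> H; apply/cvgrPdist_le => e /H [N HN]; exists N => // k Nk.
by rewrite /= sub0r normrN HN.
Qed.

Lemma seq_bound s : exists N, {in s, forall k, (k < N)%N}.
Proof.
elim: s => [|j s [N HN]]; first by exists 0%N.
exists (maxn N j.+1) => k; rewrite inE => /orP[/eqP ->|/HN kN].
  by rewrite leq_max ltnSn orbT.
by rewrite leq_max kN.
Qed.

Lemma initial_argmax x s N k0 : k0 \notin s -> (k0 < N)%N ->
  exists2 m, m \notin s & forall k, (k < N)%N -> k \notin s -> `|x k| <= `|x m|.
Proof.
elim: N k0 => // N IH k0 k0s k0N.
have [[j js jN]|H] := pselect (exists2 j, j \notin s & (j < N)%N); last first.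
  exists k0 => // k kN ks; case: (ltnP k N) => Nk; first by case: H; exists k.
  case: (ltnP k0 N) => Nk0; first by case: H; exists k0.
  by have -> : k = k0 by apply/eqP; rewrite eqn_leq; lia.
have [m ms mP] := IH j js jN.
have [/andP[Ns xm]|] := boolP ((N \notin s) && (`|x m| <= `|x N|)).
  exists N => // k; rewrite ltnS leq_eqVlt => /orP[/eqP -> //|kN ks].
  exact: le_trans (mP _ kN ks) xm.
rewrite negb_and -ltNge negbK => Nm; exists m => // k.
rewrite ltnS leq_eqVlt => /orP[/eqP ->|kN ks]; last exact: mP.
by case/orP: Nm => [-> //|/ltW].
Qed.

(** Unless [x] vanishes off [s], all late entries are below one nonzero value [|x k0|], so the
    maximum is found by a finite search. *)
Lemma c0_argmax x : x @ \oo --> (0 : R) -> forall s,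
  exists2 m, m \notin s & forall k, k \notin s -> `|x k| <= `|x m|.
Proof.
move=> x0 s; have [N0 HN0] := seq_bound s.
have N0s : N0 \notin s by apply/negP => /HN0; rewrite ltnn.
have [[k0 k0s xk0]|H] := pselect (exists2 k, k \notin s & x k != 0); last first.
  exists N0 => // k ks; have -> : x k = 0; last by rewrite normr0.
  by apply/eqP; apply: contrapT => /negP xk; apply: H; exists k.
have [N HN] : exists N, forall k, (N <= k)%N -> `|x k| <= `|x k0|.
  by apply: c0_small; rewrite ?normr_gt0.
have [||m ms mP] := @initial_argmax x s (maxn N k0.+1) k0 => //.
  by rewrite leq_max ltnSn orbT.
exists m => // k ks; case: (ltnP k N) => Nk.
  by apply: mP; rewrite // leq_max Nk.
by apply: le_trans (HN _ Nk) _; apply: mP; rewrite // leq_max ltnSn orbT.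
Qed.

Lemma xstar_lower x s (c : R) : x @ \oo --> (0 : R) -> uniq s -> (0 < size s)%N ->
  {in s, forall k, c <= `|x k|} -> c <= xstar x (size s).-1.
Proof.
move=> x0 us s0 H; apply: lb_le_inf.
  (* The infimum runs over a nonempty set: the largest modulus is admissible for every [n]. *)
  have [m _ mP] := c0_argmax x0 [::]; exists `|x m|; split=> // -[|k t]//= _.
  by rewrite ltNge mP.
move=> t [t0 /(_ s us)]; case: leP => // tc /implyP.
have -> : all (fun k => t < `|x k|) s.
  by apply/allP => k ks; apply: lt_le_trans tc (H _ ks).
by rewrite implyTb leqNgt prednK// leqnn.
Qed.

Lemma xstar_ge0 x n : x @ \oo --> (0 : R) -> 0 <= xstar x n.
Proof.
move=> x0; have := @xstar_lower x (iota 0 n.+1) 0 x0 (iota_uniq _ _).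
by rewrite size_iota => -> // k _.
Qed.

Lemma xstar_upper x s n (t : R) : 0 <= t -> (size s <= n)%N ->
  (forall k, k \notin s -> `|x k| <= t) -> xstar x n <= t.
Proof.
move=> t0 sn H; apply: ge_inf; first by exists 0 => u [].
split=> // r ur /allP Hr; apply: leq_trans sn.
apply: uniq_leq_size => // k kr; apply: contraT => /H.
by rewrite leNgt Hr.
Qed.

(** Always pick a remaining index of largest modulus: off the first [i] picks nothing exceeds the
    next one, which therefore bounds [xstar x i]. *)
Lemma xstar_greedy x n : x @ \oo --> (0 : R) -> exists s, [/\ uniq s, size s = n &
  forall i, (i < n)%N -> xstar x i <= `|x (nth 0%N s i)|].
Proof.
move=> x0; elim: n => [|n [s [us sn H]]]; first by exists [::].
have [m ms mP] := c0_argmax x0 s.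
exists (rcons s m); split; rewrite ?rcons_uniq ?ms ?size_rcons ?sn// => i.
rewrite ltnS leq_eqVlt => /orP[/eqP ->|lin]; rewrite nth_rcons sn; last first.
  by rewrite lin H.
by rewrite ltnn eqxx; apply: (@xstar_upper x s); rewrite ?sn.
Qed.

(** After sorting by decreasing modulus, the first [i.+1] entries are all at least the entry at
    position [i], which is thus at most [xstar x i]. *)
Lemma sum_le_xstar x s : x @ \oo --> (0 : R) -> uniq s ->
  \sum_(i < size s) `|x (nth 0%N s i)| <= \sum_(i < size s) xstar x i.
Proof.
move=> x0 us; pose le a b := `|x b| <= `|x a|.
have lt : total le by move=> a b; apply: le_total.
have ltr : transitive le by move=> a b c ab bc; exact: le_trans bc ab.
rewrite -(big_mkord xpredT (fun i => `|x (nth 0%N s i)|)).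
rewrite -(big_nth 0%N xpredT (fun k => `|x k|)).
rewrite (perm_big (sort le s)) 1?perm_sym ?perm_sort//=.
rewrite (big_nth 0%N) big_mkord size_sort.
apply: ler_sum => i _.
have is' : (i < size (sort le s))%N by rewrite size_sort.
have := @xstar_lower x (take i.+1 (sort le s)) `|x (nth 0%N (sort le s) i)| x0.
rewrite size_takel// => -> //; first by rewrite take_uniq// sort_uniq.
move=> k /(nthP 0%N) [j]; rewrite size_takel// => ji <-; rewrite nth_take//.
have /(sorted_leq_nth ltr (fun _ => lexx _)) := sort_sorted lt s.
by apply; rewrite ?inE// (leq_ltn_trans _ is').
Qed.

(** Every initial part of [s] sums to at most the matching part of the rearrangement, and decreasing
    weights preserve this by Abel summation. *)
Lemma wsum_le_lnorm x s : x @ \oo --> (0 : R) -> uniq s ->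
  ((wsum 0 s x)%:E <= lnorm w x)%E.
Proof.
move=> x0 us; have T0 n : (0 <= (w n * xstar x n)%:E)%E.
  by rewrite lee_fin mulr_ge0 ?weight_ge0 ?xstar_ge0.
have := @nneseries_lim_ge _ _ xpredT 0%N (size s) (fun n _ _ => T0 n).
apply: le_trans.
rewrite sumEFin lee_fin wsumE big_mkord; 
apply: (@weighted_sum_le (fun i => `|x (nth 0%N s i)|) (xstar x)) => m ms.
have := @sum_le_xstar x (take m s) x0 (take_uniq _ us); rewrite size_takel//.
by under eq_bigr => i _ do rewrite nth_take//.
Qed.

(** A greedy list dominates each partial sum of the series that defines the norm. *)
Lemma lnorm_le x (M : R) : x @ \oo --> (0 : R) ->
  (forall s, uniq s -> wsum 0 s x <= M) -> (lnorm w x <= M%:E)%E.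
Proof.
move=> x0 H; have T0 n : (0 <= (w n * xstar x n)%:E)%E.
  by rewrite lee_fin mulr_ge0 ?weight_ge0 ?xstar_ge0.
apply: lime_le; first by apply: is_cvg_nneseries.
apply: nearW => n; rewrite sumEFin lee_fin big_mkord.
have [s [us sn Hs]] := xstar_greedy n x0.
apply: le_trans (H s us); rewrite wsumE sn; apply: ler_sum => i _.
by rewrite ler_wpM2l ?weight_ge0 ?Hs.
Qed.

(** * The norm as a real number *)

Definition nrm x : R := fine (lnorm w x).

Lemma nrmE x : in_d w x -> lnorm w x = (nrm x)%:E.
Proof.
move=> [x0 xoo]; rewrite fineK// ge0_fin_numE//.
by have := @wsum_le_lnorm x [::] x0 isT.
Qed.

Lemma wsum_le_nrm x s : in_d w x -> uniq s -> wsum 0 s x <= nrm x.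
Proof. by move=> xd us; rewrite -lee_fin -nrmE// wsum_le_lnorm//; case: xd. Qed.

Lemma nrm_le x (M : R) : in_d w x -> (forall s, uniq s -> wsum 0 s x <= M) ->
  nrm x <= M.
Proof. by move=> xd H; rewrite -lee_fin -nrmE// lnorm_le//; case: xd. Qed.

Lemma nrm_approx x (e : R) : in_d w x -> 0 < e ->
  exists2 s, uniq s & nrm x - e < wsum 0 s x.
Proof.
move=> xd e0; apply: contrapT => H; suff : nrm x <= nrm x - e by lra.
apply: nrm_le => // s us; rewrite leNgt; apply/negP => Hs; apply: H.
by exists s.
Qed.

Lemma nrm_ge0 x : in_d w x -> 0 <= nrm x.
Proof. by move=> xd; have := @wsum_le_nrm x [::] xd isT. Qed.

(** Convergence to 0 comes for free: otherwise arbitrarily many entries have modulus at least some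
    [e > 0], and the divergence of the weights makes their weighted sum exceed [M]. *)
Lemma wsum_bounded_in_d x (M : R) :
  (forall s, uniq s -> wsum 0 s x <= M) -> in_d w x.
Proof.
move=> H; suff x0 : x @ \oo --> (0 : R).
  by split=> //; rewrite (le_lt_trans (lnorm_le x0 H))// ltry.
apply: small_c0 => e e0; apply: contrapT => /forallNP Hn.
have {}Hn N : exists2 k, (N <= k)%N & e <= `|x k|.
  have /existsNP [k /not_implyP [Nk /negP]] := Hn N.
  by rewrite -ltNge => /ltW; exists k.
have Hs n : exists s, [/\ uniq s, size s = n & {in s, forall k, e <= `|x k|}].
  elim: n => [|n [s [us sn se]]]; first by exists [::].
  have [N HN] := seq_bound s; have [k Nk ek] := Hn N.
  exists (k :: s); split=> /=; rewrite ?sn//.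
    by rewrite us andbT; apply/negP => /HN; rewrite ltnNge Nk.
  by move=> j; rewrite inE => /orP[/eqP ->|/se].
have [n Mn] := weight_sum_unbounded (M / e + 1).
have [s [us sn se]] := Hs n.
have := le_trans (wsum_ge_const 0 se) (H s us).
rewrite sn; under eq_bigr do rewrite add0n.
rewrite mulrC -ler_pdivlMr//; lra.
Qed.

Lemma in_d_le x y : in_d w y -> (forall k, `|x k| <= `|y k|) ->
  in_d w x /\ nrm x <= nrm y.
Proof.
move=> yd xy.
have H s : uniq s -> wsum 0 s x <= nrm y.
  by move=> us; apply: le_trans (wsum_le_nrm yd us); apply: wsum_le => k _.
have xd := wsum_bounded_in_d H; split=> //; exact: nrm_le.
Qed.

Lemma in_d_lin a x y : in_d w x -> in_d w y ->
  in_d w (fun k => a * x k + y k).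
Proof.
move=> xd yd; apply: (@wsum_bounded_in_d _ (`|a| * nrm x + nrm y)) => s us.
by rewrite (le_trans (wsumD _ _ _ _ _))// lerD ?ler_wpM2l ?wsum_le_nrm.
Qed.

Lemma nrm_lin a x y : in_d w x -> in_d w y ->
  nrm (fun k => a * x k + y k) <= `|a| * nrm x + nrm y.
Proof.
move=> xd yd; apply: nrm_le; first exact: in_d_lin.
move=> s us; rewrite (le_trans (wsumD _ _ _ _ _))//.
by rewrite lerD ?ler_wpM2l ?wsum_le_nrm.
Qed.

Lemma in_d0 : in_d w (fun=> 0).
Proof.
by apply: (@wsum_bounded_in_d _ 0) => s _; rewrite wsumE big1// => i _;
  rewrite normr0 mulr0.
Qed.

Lemma nrm0 : nrm (fun=> 0) = 0.
Proof.
apply/eqP; rewrite eq_le nrm_ge0 ?andbT; last exact: in_d0.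
apply: nrm_le; first exact: in_d0.
by move=> s _; rewrite wsumE big1// => i _; rewrite normr0 mulr0.
Qed.

Lemma in_dZ a x : in_d w x -> in_d w (fun k => a * x k).
Proof.
move=> xd; have := in_d_lin a xd in_d0.
by congr in_d; apply/funext => k; rewrite addr0.
Qed.

Lemma nrmZ a x : in_d w x -> nrm (fun k => a * x k) <= `|a| * nrm x.
Proof.
move=> xd; have := nrm_lin a xd in_d0; rewrite nrm0 addr0.
by congr (nrm _ <= _); apply/funext => k; rewrite addr0.
Qed.

Lemma in_dB x y : in_d w x -> in_d w y -> in_d w (fun k => x k - y k).
Proof.
move=> xd yd; have := in_d_lin (-1) yd xd.
by congr in_d; apply/funext => k; rewrite mulN1r addrC.
Qed.

Lemma nrmB x y : in_d w x -> in_d w y -> nrm (fun k => x k - y k) <= nrm x + nrm y.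
Proof.
move=> xd yd; have := nrm_lin (-1) yd xd; rewrite normrN1 mul1r addrC.
by congr (nrm _ <= _); apply/funext => k; rewrite mulN1r addrC.
Qed.

Lemma nrm_subC x y : nrm (fun k => x k - y k) = nrm (fun k => y k - x k).
Proof.
rewrite /nrm /lnorm; congr fine; congr (limn _); apply/funext => n.
apply: eq_bigr => i _; congr (_ * _)%:E; rewrite /xstar; congr inf.
apply/funext => t; apply/propext; rewrite /=.
by under eq_forall do under eq_all do rewrite distrC.
Qed.

Lemma nrm_le_dist x y : in_d w x -> in_d w y ->
  nrm x <= nrm (fun k => x k - y k) + nrm y.
Proof.
move=> xd yd; have := nrm_lin 1 (in_dB xd yd) yd; rewrite normr1 mul1r.
by congr (nrm _ <= _); apply/funext => k; rewrite mul1r subrK.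
Qed.

Lemma coord_le_nrm x k : in_d w x -> `|x k| <= nrm x.
Proof.
by move=> xd; have := @wsum_le_nrm x [:: k] xd isT; rewrite /= w0 mul1r addr0.
Qed.

Lemma nrm_gt0 x : in_d w x -> x <> (fun=> 0) -> 0 < nrm x.
Proof.
move=> xd xn0; rewrite lt_neqAle nrm_ge0// andbT eq_sym; apply/negP => /eqP n0.
apply: xn0; apply/funext => k; apply/eqP; rewrite -normr_le0 -n0.
exact: coord_le_nrm.
Qed.

(* Append a far away block to a nearly norming list: the block is then weighted
   by the small shifted weights, and undoing the shift costs little since [x]
   is small on the block. *)
Lemma tail_small x (e : R) : in_d w x -> 0 < e ->
  exists N, forall s, uniq s -> {in s, forall k, (N <= k)%N} -> wsum 0 s x <= e.
Proof.
move=> xd e0; have e2 : 0 < e / 2 by rewrite divr_gt0.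
have [r ur rx] := nrm_approx xd e2.
set n := size r; pose h := e / 2 / n.+1%:R.
have h0 : 0 < h by rewrite divr_gt0.
have [N1 HN1] := seq_bound r.
have [N2 HN2] := c0_small xd.1 h0.
exists (maxn N1 N2) => s us sN.
have urs : uniq (r ++ s).
  rewrite cat_uniq ur us andbT; apply/hasPn => k /sN; rewrite geq_max => /andP[+ _].
  by move=> N1k; apply/negP => /HN1; rewrite ltnNge N1k.
have H1 := wsum_le_nrm xd urs; rewrite wsum_cat add0n in H1.
have H2 : wsum 0 s x <= wsum n s x + n%:R * h.
  apply: (@wsum_shift n 0); rewrite ?ltW// => k /sN.
  by rewrite geq_max => /andP[_ /HN2].
have H3 : n.+1%:R * h = e / 2 by rewrite /h mulrC divfK.
rewrite -natr1 mulrDl mul1r in H3; rewrite -/n in H1; lra.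
Qed.

(** * Finite linear combinations *)

Definition comb n (a : nat -> R) (z : nat -> nat -> R) : nat -> R :=
  fun k => \sum_(i < n) a i * z i k.

Lemma comb0 (a : nat -> R) (z : nat -> nat -> R) : comb 0 a z = fun=> 0.
Proof. by apply/funext => k; rewrite /comb big_ord0. Qed.

Lemma combS n (a : nat -> R) (z : nat -> nat -> R) :
  comb n.+1 a z = fun k => a n * z n k + comb n a z k.
Proof. by apply/funext => k; rewrite /comb big_ord_recr /= addrC. Qed.

Lemma in_d_comb n (a : nat -> R) (z : nat -> nat -> R) :
  (forall i, in_d w (z i)) -> in_d w (comb n a z).
Proof.
move=> zd; elim: n => [|n IH]; first by rewrite comb0; exact: in_d0.
by rewrite combS; apply: in_d_lin.
Qed.

Lemma nrm_comb n (a : nat -> R) (z : nat -> nat -> R) (M : R) :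
  (forall i, in_d w (z i)) ->
  (forall i, nrm (z i) <= M) -> nrm (comb n a z) <= M * \sum_(i < n) `|a i|.
Proof.
move=> zd zM; elim: n => [|n IH]; first by rewrite comb0 big_ord0 mulr0 nrm0.
rewrite combS (le_trans (nrm_lin _ (zd n) (in_d_comb n a zd)))//.
by rewrite big_ord_recr /= mulrDr addrC lerD// mulrC ler_wpM2r.
Qed.

(** * Functionals given by a growing list of indices *)

Section ListFunctional.
Variables l t : nat -> seq nat.
Hypothesis l_uniq : forall n, uniq (l n).
Hypothesis l_cat : forall n, l n.+1 = l n ++ t n.

(** The [l n] are initial segments of a single list [tau] without repetition, and this is the sum of
    [w i * x (tau i)]. *)
Definition list_functional x : R := limn (fun n => vsum 0 (l n) x).

(** Absolute convergence: [wsum] and [vsum + wsum] are both nondecreasing along the lists and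
    bounded through [nrm x], and [vsum] is their difference. *)
Lemma list_functional_cvg x : in_d w x -> cvgn (fun n => vsum 0 (l n) x).
Proof.
move=> xd.
have Hw : cvgn (fun n => wsum 0 (l n) x).
  apply: nondecreasing_is_cvgn.
    by apply/nondecreasing_seqP => n; rewrite l_cat wsum_cat lerDl wsum_ge0.
  by exists (nrm x) => _ [n _ <-]; exact: wsum_le_nrm.
have Hv : cvgn (fun n => vsum 0 (l n) x + wsum 0 (l n) x).
  apply: nondecreasing_is_cvgn.
    apply/nondecreasing_seqP => n; rewrite l_cat wsum_cat vsum_cat addrACA lerDl.
    by have := norm_vsum (0 + size (l n)) (t n) x; rewrite ler_norml; lra.
  exists (nrm x + nrm x) => _ [n _ <-]; apply: lerD; last exact: wsum_le_nrm.
  by rewrite (le_trans (ler_norm _))// (le_trans (norm_vsum _ _ _))// wsum_le_nrm.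
rewrite [X in cvgn X](_ : _ = (fun n => (vsum 0 (l n) x + wsum 0 (l n) x)
  - wsum 0 (l n) x)); first exact: is_cvgB.
by apply/funext => n; rewrite addrK.
Qed.

Lemma list_functional_ge x (c : R) n : in_d w x ->
  (forall m, (n <= m)%N -> c <= vsum 0 (l m) x) -> c <= list_functional x.
Proof.
move=> xd H; apply: limr_ge; first exact: list_functional_cvg.
by exists n.
Qed.

Lemma list_functional_dual : is_dual w list_functional.
Proof.
split=> [a x y xd yd|].
  apply/cvg_lim => //; rewrite [X in X @ _ --> _](_ : _ =
    (fun n => a * vsum 0 (l n) x + vsum 0 (l n) y)).
    by apply: cvgD; [apply: cvgMr|]; exact: list_functional_cvg.
  by apply/funext => n; rewrite vsum_lin.
exists 1 => x xd; rewrite mul1e nrmE// lee_fin ler_norml.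
have H n : `|vsum 0 (l n) x| <= nrm x.
  by rewrite (le_trans (norm_vsum _ _ _))// wsum_le_nrm.
apply/andP; split.
  apply: (@list_functional_ge _ _ 0) => // m _.
  by have := H m; rewrite ler_norml => /andP[].
apply: limr_le; first exact: list_functional_cvg.
by apply: nearW => n; rewrite (le_trans (ler_norm _)).
Qed.

End ListFunctional.

(** * Flat vectors in infinite-dimensional subspaces *)

Section FlatVectors.
Variable Z : set (nat -> R).
Hypothesis Z_in_d : Z `<=` in_d w.
Hypothesis Z_0 : Z (fun=> 0).
Hypothesis Z_lin : forall a x y, Z x -> Z y -> Z (fun k => a * x k + y k).
Hypothesis Z_far : forall N, exists2 z, Z z &
  z <> (fun=> 0) /\ forall k, (k < N)%N -> z k = 0.

Lemma Z_scale a x : Z x -> Z (fun k => a * x k).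
Proof.
move=> Zx; have := Z_lin a Zx Z_0.
by congr Z; apply/funext => k; rewrite addr0.
Qed.

Lemma far_peak N : exists z k0, [/\ Z z, forall k, (k < N)%N -> z k = 0,
  forall k, `|z k| <= 1 & `|z k0| = 1].
Proof.
have [z Zz [zn0 zN]] := Z_far N.
have [m _ mP] := c0_argmax (Z_in_d Zz).1 [::].
have zm0 : 0 < `|z m|.
  rewrite normr_gt0; apply/eqP => zm; apply: zn0; apply/funext => k.
  by apply/eqP; rewrite -normr_le0 (le_trans (mP _ _))// zm normr0.
exists (fun k => `|z m|^-1 * z k), m; split.
- exact: Z_scale.
- by move=> k kN /=; rewrite (zN k)// mulr0.
- by move=> k; rewrite normrM normfV normr_id ler_pdivrMl// mulr1 mP.
- by rewrite normrM normfV normr_id mulVf// gt_eqF.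
Qed.

(* [v] peaks at [k0] and is below [h] from [N1] on, so adding a plateau supported
   beyond [N1] and [k0] perturbs both by at most [h]. *)
Lemma far_plateau (h : R) m : 0 < h -> m%:R * h <= 1 / 2 -> forall N, exists z s,
  [/\ Z z, forall k, (k < N)%N -> z k = 0, forall k, `|z k| <= 1 + m%:R * h &
  [/\ uniq s, size s = m & {in s, forall k, 1 - m%:R * h <= `|z k|}]].
Proof.
move=> h0; elim: m => [|m IH] mh N.
  by exists (fun=> 0), [::]; split=> // k; rewrite normr0 mul0r addr0 ler01.
rewrite -natr1 mulrDl mul1r in mh *.
have [v [k0 [Zv vN v1 vk0]]] := far_peak N.
have [N1 HN1] := c0_small (Z_in_d Zv).1 h0.
have [|z [s [Zz zN1 z1 [us sm sz]]]] := IH _ (maxn (maxn N N1) k0.+1); first lra.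
have zk0 : z k0 = 0 by rewrite zN1// leq_max ltnSn orbT.
have m0 : 0 <= m%:R * h by rewrite mulr_ge0 ?ler0n ?(ltW h0).
exists (fun k => 1 * v k + z k), (k0 :: s); split.
- exact: Z_lin.
- by move=> k kN /=; rewrite (vN k)// zN1 ?mulr0 ?addr0// !leq_max kN.
- move=> k; rewrite mul1r; case: (ltnP k N1) => kN1.
    rewrite zN1 ?leq_max ?kN1 ?orbT// addr0 (le_trans (v1 k))//; lra.
  by rewrite (le_trans (ler_normD _ _))//; have := HN1 k kN1; have := z1 k; lra.
split.
- rewrite /= us andbT; apply/negP => /sz; rewrite zk0 normr0; lra.
- by rewrite /= sm.
move=> k; rewrite inE => /orP[/eqP ->|ks].
  by rewrite zk0 addr0 mul1r vk0; lra.
have zk := sz _ ks; have kN1 : (N1 <= k)%N.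
  rewrite leqNgt; apply/negP => kN1.
  rewrite zN1 ?normr0 ?leq_max ?kN1 ?orbT// in zk; lra.
have := HN1 k kN1; have := lerB_normD (z k) (v k).
by rewrite mul1r [v k + _]addrC; lra.
Qed.

Lemma flat_vector (e : R) N : 0 < e -> exists z,
  [/\ Z z, forall k, (k < N)%N -> z k = 0, nrm z = 1 & forall k, `|z k| <= e].
Proof.
(* A plateau of [m] entries at least 1/2 has norm at least [3 / (2 * e)], while all entries are at
   most 3/2; normalising brings them below [e]. *)
move=> e0; have [m Mm] := weight_sum_unbounded (3 / e).
pose h : R := 2^-1 / m.+1%:R.
have h0 : 0 < h by rewrite divr_gt0.
have hm : m.+1%:R * h = 1 / 2 by rewrite /h mulrC divfK// div1r.
rewrite -natr1 mulrDl mul1r in hm.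
have [||z [s [Zz zN z1 [us sm sz]]]] := @far_plateau h m _ _ N => //; first lra.
have zd := Z_in_d Zz; set c := nrm z.
have cge : 3 / e <= 2 * c.
  have H : {in s, forall k, 1 / 2 <= `|z k|} by move=> k /sz; lra.
  have := le_trans (wsum_ge_const 0 H) (wsum_le_nrm zd us).
  rewrite sm -/c; under eq_bigr do rewrite add0n.
  by lra.
have c0 : 0 < c by have : 0 < 3 / e by [rewrite divr_gt0]; lra.
exists (fun k => c^-1 * z k); split.
- exact: Z_scale.
- by move=> k kN /=; rewrite (zN k)// mulr0.
- apply/eqP; rewrite eq_le; apply/andP; split.
    rewrite (le_trans (nrmZ _ zd))// ger0_norm ?invr_ge0 ?(ltW c0)//.
    by rewrite mulVf ?gt_eqF.
  have := nrmZ c (in_dZ c^-1 zd); rewrite ger0_norm ?(ltW c0)//.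
  have -> : (fun k => c * (c^-1 * z k)) = z.
    by apply/funext => k; rewrite mulrA divff ?mul1r// gt_eqF.
  by rewrite -/c -[leLHS]mulr1 ler_pM2l.
- move=> k; rewrite normrM gtr0_norm ?invr_gt0// ler_pdivrMl//.
  rewrite (le_trans (z1 k))//; move: cge; rewrite ler_pdivrMr//; lra.
Qed.

(** A list of weight above 3/4 splits by the sign of [z], and one part has weight at least 3/8.
    Replacing [z] by its negative if necessary makes the entries on that part positive, so that
    [vsum] and [wsum] agree there. *)
Lemma flat_block N L : exists z t, [/\ Z z, nrm z <= 1,
  forall k, (k < N)%N -> z k = 0 & [/\ uniq t, {in t, forall k, 0 < z k} &
  1 / 4 <= wsum L t z]].
Proof.
(* Moving the list by [L] positions then costs at most [L * e <= 1 / 8], which leaves 1/4 of the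
   3/8. *)
pose e : R := 8^-1 / L.+1%:R.
have e0 : 0 < e by rewrite divr_gt0.
have eL : L.+1%:R * e = 1 / 8 by rewrite /e mulrC divfK// div1r.
rewrite -natr1 mulrDl mul1r in eL.
have [z [Zz zN z1 ze]] := flat_vector N e0.
have zd := Z_in_d Zz.
have [||s us] := @nrm_approx z (1 / 4) => //; rewrite z1 => Hs.
pose p := [seq k <- s | 0 < z k]; pose q := [seq k <- s | z k < 0].
have H0 : wsum 0 s z <= wsum 0 p z + wsum 0 q z.
  rewrite (le_trans (wsum_filter 0 s z (fun k => 0 < z k)))// lerD2l.
  rewrite (le_trans (wsum_filter 0 _ z (fun k => z k < 0)))// -filter_predI.
  rewrite [X in _ + X](_ : _ = 0) ?addr0.
    rewrite le_eqVlt (@eq_filter _ _ (fun k => z k < 0)) ?eqxx// => k /=.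
    by case: ltgtP.
  apply: le_anti; rewrite wsum_ge0 andbT.
  apply: le_trans (wsum_le_const (lexx 0) _) _; last by rewrite mulr0.
  move=> k; rewrite !mem_filter => /and3P[]; rewrite -!leNgt => ? ? _.
  by rewrite normr_le0; apply/eqP/le_anti/andP.
have [Hp|Hp] := leP (3 / 8) (wsum 0 p z).
  exists z, p; split=> //; first by rewrite z1.
  split; first exact: filter_uniq.
    by move=> k; rewrite mem_filter => /andP[].
  have := @wsum_shift L 0 p z e (ltW e0) (fun k _ => ze k); rewrite add0n; lra.
have qe n : wsum n q (fun k => -1 * z k) = wsum n q z.
  rewrite !wsumE; apply: eq_bigr => i _.
  by rewrite normrM normrN1 mul1r.
exists (fun k => -1 * z k), q; split=> //; first exact: Z_scale.
- by rewrite (le_trans (nrmZ _ zd))// normrN1 mul1r z1.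
- by move=> k kN /=; rewrite (zN k)// mulr0.
split; first exact: filter_uniq.
  by move=> k; rewrite mem_filter mulN1r oppr_gt0 => /andP[].
have := @wsum_shift L 0 q z e (ltW e0) (fun k _ => ze k); rewrite add0n.
rewrite -(qe L); lra.
Qed.

(** Such a sequence has no weak cluster point: its coordinates tend to 0, yet [g] stays away from 0
    on it. *)
Lemma escaping_sequence : exists2 g : (nat -> R) -> R, is_dual w g &
  exists z : nat -> nat -> R, forall n,
    [/\ Z (z n), nrm (z n) <= 1, 1 / 8 <= g (z n) &
        forall k, (k < n)%N -> z n k = 0].
Proof.
(* [lN] holds the list built so far and a bound for its indices; [r] holds the next vector, the
   indices to append, and the next bound, beyond which that vector has weight at most 1/8. *)
pose P (lN : seq nat * nat) (r : (nat -> R) * seq nat * nat) :=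
  [/\ Z r.1.1, nrm r.1.1 <= 1, forall k, (k < lN.2)%N -> r.1.1 k = 0,
      uniq r.1.2 & {in r.1.2, forall k, 0 < r.1.1 k}] /\
  [/\ 1 / 4 <= wsum (size lN.1) r.1.2 r.1.1, (lN.2 < r.2)%N,
      {in r.1.2, forall k, (k < r.2)%N} &
      forall s, uniq s -> {in s, forall k, (r.2 <= k)%N} ->
        wsum 0 s r.1.1 <= 1 / 8].
have /choice [step stepP] : forall lN, exists r, P lN r.
  move=> [l N]; have [z [t [Zz z1 zN [ut tz Wt]]]] := flat_block N (size l).
  have [N1 HN1] := seq_bound t.
  have [|N2 HN2] := @tail_small z (1 / 8) (Z_in_d Zz); first by rewrite divr_gt0.
  exists (z, t, maxn N.+1 (maxn N1 N2)); split; split=> //=.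
  - by rewrite leq_max leqnn.
  - by move=> k /HN1 kN1; rewrite !leq_max kN1 orbT.
  - by move=> s us Hs; apply: HN2 => // k /Hs; rewrite !geq_max => /and3P[].
pose st := fix st n := if n is m.+1 then
  ((st m).1 ++ (step (st m)).1.2, (step (st m)).2) else ([::], 0%N).
pose l n := (st n).1; pose N n := (st n).2.
pose z n := (step (st n)).1.1; pose t n := (step (st n)).1.2.
have l_cat n : l n.+1 = l n ++ t n by [].
have NS n : (N n < N n.+1)%N by have [_ []] := stepP (st n).
have Nm := homo_leq leqnn leq_trans (fun n => ltnW (NS n)).
have Nn n : (n <= N n)%N by elim: n => // n IH; exact: leq_ltn_trans IH (NS n).
(* The lower bound holds because [z n] vanishes below [N n] but is positive on [t n]. *)
have tN n : {in t n, forall k, (N n <= k < N n.+1)%N}.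
  move=> k kt; have [[_ _ zN _ tz] [_ _ tN _]] := stepP (st n).
  apply/andP; split; last exact: tN.
  rewrite leqNgt; apply/negP => /zN zk; have := tz k kt.
  by rewrite zk ltxx.
have lN n : {in l n, forall k, (k < N n)%N}.
  elim: n => // n IH k; rewrite l_cat mem_cat => /orP[/IH kN|/tN /andP[]//].
  exact: ltn_trans kN (NS n).
have l_uniq n : uniq (l n).
  elim: n => // n IH; rewrite l_cat cat_uniq IH /=.
  have [[_ _ _ -> _] _] := stepP (st n); rewrite andbT.
  by apply/hasPn => k /tN /andP[Nk _]; apply/negP => /lN; rewrite ltnNge Nk.
have l_rest n d : exists2 r, l (n + d)%N = l n ++ r &
    {in r, forall k, (N n <= k)%N}.
  elim: d => [|d [r rE rN]]; first by exists [::]; rewrite ?addn0 ?cats0.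
  exists (r ++ t (n + d)%N); first by rewrite addnS l_cat rE catA.
  move=> k; rewrite mem_cat => /orP[/rN//|/tN /andP[Nk _]].
  by rewrite (leq_trans _ Nk)// Nm// leq_addr.
exists (list_functional l); first exact: (list_functional_dual l_uniq l_cat).
exists z => n; have [[Zz z1 zN ut tz] [Wt _ _ tail]] := stepP (st n).
split=> //; last by move=> k kn; apply: zN; exact: leq_trans kn (Nn n).
apply: (list_functional_ge l_uniq l_cat (n := n.+1)); first exact: Z_in_d.
move=> m nm; have [r] := l_rest n.+1 (m - n.+1)%N; rewrite subnKC// => rE rN.
(* The earlier indices contribute 0, [t n] at least 1/4, and the later indices [r] at most 1/8 in
   modulus. *)
rewrite rE l_cat -catA !vsum_cat add0n [X in X + _]vsum0 ?add0r; last first.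
  by move=> k /lN; exact: zN.
rewrite [X in X + _]vsum_wsum//.
have ur : uniq r by have := l_uniq m; rewrite rE cat_uniq => /and3P[].
have := norm_vsum (size (l n) + size (t n)) r (z n).
have := wsum_shift_le 0 (size (l n) + size (t n)) r (z n).
have := tail r ur rN; rewrite add0n -/(z n) -/(t n).
have := ler_norm (- vsum (size (l n) + size (t n)) r (z n)); rewrite normrN.
move: Wt; rewrite -/(z n) -/(t n) -/(l n); lra.
Qed.

End FlatVectors.

(** * Infinite-dimensional subspaces and the weak topology *)

(** If [f y0] is nonzero, each [y] in [Y] is a multiple of [y0] plus a kernel element, so a finite
    list spanning the kernel would span [Y] once [y0] is added. *)
Lemma infinite_dim_ker (Y : set (nat -> R)) (f : (nat -> R) -> R) :
  Y (fun=> 0) ->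
  (forall a x y, Y x -> Y y -> Y (fun k => a * x k + y k)) ->
  (forall a x y, Y x -> Y y -> f (fun k => a * x k + y k) = a * f x + f y) ->
  infinite_dim Y -> infinite_dim [set y | Y y /\ f y = 0].
Proof.
move=> Y0 Ylin flin Yinf s.
have [[y0 Yy0 fy0]|H] := pselect (exists2 y0, Y y0 & f y0 != 0); last first.
  have [y Yy ys] := Yinf s; exists y => //; split=> //.
  by apply: contrapT => /eqP fy; apply: H; exists y.
apply: contrapT => H; have [y Yy ys] := Yinf (y0 :: s).
pose b := f y / f y0; pose y' k := - b * y0 k + y k.
apply: H; exists y'; first split; first exact: Ylin.
  by rewrite flin// mulNr divfK// addNr.
move=> c y'E; apply: (ys (fun i => if i is j.+1 then c j else b)).
apply/funext => k; rewrite big_ord_recl /=.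
by have /(congr1 (fun u => u k)) := y'E; rewrite /y' /= => <-; ring.
Qed.

(** If [n] vectors spanned [Y], the coefficient matrix of the first [n.+1] vectors [z i] would have
    more rows than columns; a nonzero row vector killed by it is a nontrivial vanishing
    combination. *)
Lemma infinite_dim_free (Y : set (nat -> R)) (z : nat -> nat -> R) :
  (forall i, Y (z i)) ->
  (forall n a, comb n a z = (fun=> 0) -> forall i, (i < n)%N -> a i = 0) ->
  infinite_dim Y.
Proof.
move=> Yz zfree s; apply: contrapT => H.
have /choice [c cP] : forall i, exists c : nat -> R,
    z i = fun k => \sum_(j < size s) c j * nth (fun=> 0) s j k.
  by move=> i; apply: contrapT => /forallNP zi; apply: H; exists (z i).
set n := size s in cP; pose M : 'M[R]_(n.+1, n) := \matrix_(i, j) c i j.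
have /rowV0Pn [v /sub_kermxP vM vn0] : kermx M != 0.
  by rewrite -mxrank_eq0 mxrank_ker subn_eq0 -ltnNge ltnS rank_leq_col.
suff a0 : forall i, (i < n.+1)%N -> v 0 (inord i) = 0.
  move/eqP: vn0; apply; apply/rowP => i; rewrite mxE -(a0 i) //.
  by rewrite inord_val.
apply: zfree; apply/funext => k; rewrite /comb.
under eq_bigr => i _ do rewrite cP inord_val mulr_sumr.
rewrite exchange_big big1//= => j _.
have /(congr1 (fun u : 'rV_n => u 0 j)) := vM; rewrite !mxE => vMj.
transitivity ((\sum_i v 0 i * M i j) * nth (fun=> 0) s j k).
  by rewrite mulr_suml; apply: eq_bigr => i _; rewrite mxE mulrA.
by rewrite vMj mul0r.
Qed.

(** The weak topology is initial for [ev] and the projections of the product are continuous, so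
    every functional is weakly continuous. *)
Lemma nbhs_weak_d (f : (nat -> R) -> R) (p : weak_d w) (e : R) :
  in_d w p -> is_dual w f -> 0 < e ->
  nbhs p [set q : weak_d w | `|f p - f q| < e].
Proof.
move=> pd fd e0; rewrite /nbhs /= -nbhs_subspace_in//.
pose F : dualT w := exist _ f fd.
have cF : continuous (fun q : weakT w => @ev R w q F).
  move=> q; apply: (@continuous_comp _ _ _ (@ev R w : weakT w -> _) (fun h => h F)).
    exact: initial_continuous.
  set g := ev q.
  have /cvg_sup /(_ F) gF : g --> g by exact: cvg_id.
  apply: cvg_trans (cvg_app _ gF) _.
  exact: (@initial_continuous _ _ (fun h : dualT w -> R => h F)).
have /cvgrPdist_lt /(_ e e0) H := cF p.
by rewrite /within /=; apply: filterS H => q qe _.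
Qed.

Lemma cvg_weak_d (F : set_system (weak_d w)) (p : weak_d w) :
  Filter F -> F (in_d w) -> in_d w p ->
  (forall f, is_dual w f -> forall e, 0 < e ->
     F [set q : weak_d w | `|f p - f q| < e]) ->
  F --> p.
Proof.
move=> FF Fd pd H A; rewrite {1}/nbhs /= -nbhs_subspace_in// => pA.
have Fp : F --> (p : weakT w).
  have evF : ev q @[q --> F] --> (ev p : prod_topology (fun _ : dualT w => R)).
    (* Convergence in the product is tested on each factor; constant functions show that the
       projections are onto. *)
    apply/cvg_sup => f; apply/cvg_image.
      by rewrite predeqE => r; split=> // _; exists (fun=> r).
    move=> C /nbhs_ballP [e /= e0 eC].
    exists ((fun h : dualT w -> R => h f) @^-1` C).
      have := H (proj1_sig f) (proj2_sig f) e e0.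
      by apply: (@filterS _ F) => q qe; exact: eC.
    by apply: image_preimage; rewrite predeqE => r; split=> // _; exists (fun=> r).
  move=> B; rewrite nbhsE => -[_ [[C Cop <-] Cp] CB].
  apply: (@filterS _ F _ _ _ CB); apply: evF; exact: open_nbhs_nbhs.
by apply: (@filterS2 _ F _ _ _ _ _ Fd (Fp _ pA)) => q qd; exact.
Qed.

Lemma unit_ballP x : unit_ball w x <-> in_d w x /\ nrm x <= 1.
Proof.
by rewrite /unit_ball /=; split=> -[xd H]; split=> //; move: H;
  rewrite nrmE// lee_fin.
Qed.

Lemma dual_nrm (f : (nat -> R) -> R) : is_dual w f ->
  exists2 C, 0 < C & forall x, in_d w x -> `|f x| <= C * nrm x.
Proof.
move=> [_ [C fC]]; exists (`|C| + 1) => [|x xd]; first by rewrite ltr_pwDr.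
have := fC x xd; rewrite nrmE// -EFinM lee_fin => /le_trans; apply.
by rewrite ler_wpM2r ?nrm_ge0// (le_trans (ler_norm _))// lerDl.
Qed.

Lemma bounded_op_nrm T : bounded_op w T ->
  exists2 C, 0 < C & forall x, in_d w x -> nrm (T x) <= C * nrm x.
Proof.
move=> [Td _ [C TC]]; exists (`|C| + 1) => [|x xd]; first by rewrite ltr_pwDr.
have := TC x xd; rewrite !nrmE; [|by []|exact: Td]; rewrite -EFinM lee_fin.
move=> /le_trans; apply.
by rewrite ler_wpM2r ?nrm_ge0// (le_trans (ler_norm _))// lerDl.
Qed.

Lemma lin0E : (fun=> 0) = (fun k : nat => 1 * (fun=> 0 : R) k + (fun=> 0) k).
Proof. by apply/funext => k; rewrite mul1r addr0. Qed.

Lemma dual0 (f : (nat -> R) -> R) : is_dual w f -> f (fun=> 0) = 0.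
Proof.
move=> [flin _]; have := flin 1 _ _ in_d0 in_d0.
rewrite -lin0E mul1r; lra.
Qed.

Lemma bounded_op0 T : bounded_op w T -> T (fun=> 0) = (fun=> 0).
Proof.
move=> [_ Tlin _]; apply/funext => k.
have /(congr1 (fun u => u k)) := Tlin 1 _ _ in_d0 in_d0.
rewrite -lin0E mul1r; lra.
Qed.

Lemma dualZ (f : (nat -> R) -> R) a x : is_dual w f -> in_d w x ->
  f (fun k => a * x k) = a * f x.
Proof.
move=> fd xd; have := fd.1 a x _ xd in_d0; rewrite (dual0 fd) addr0 => <-.
by congr f; apply/funext => k; rewrite addr0.
Qed.

Lemma bounded_opZ T a x : bounded_op w T -> in_d w x ->
  T (fun k => a * x k) = (fun k => a * T x k).
Proof.
move=> bT xd; have [_ Tlin _] := bT.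
have := Tlin a x _ xd in_d0; rewrite (bounded_op0 bT) => TE.
have -> : (fun k => a * x k) = (fun k => a * x k + 0).
  by apply/funext => k; rewrite addr0.
by rewrite TE; apply/funext => k; rewrite addr0.
Qed.

Lemma dualB (f : (nat -> R) -> R) x y : is_dual w f -> in_d w x -> in_d w y ->
  f (fun k => x k - y k) = f x - f y.
Proof.
move=> fd xd yd; have := fd.1 (-1) y x yd xd; rewrite mulN1r addrC => <-.
by congr f; apply/funext => k; rewrite mulN1r addrC.
Qed.

Lemma bounded_opB T x y : bounded_op w T -> in_d w x -> in_d w y ->
  T (fun k => x k - y k) = (fun k => T x k - T y k).
Proof.
move=> [_ Tlin _] xd yd; have := Tlin (-1) y x yd xd.
have -> : (fun k => -1 * y k + x k) = (fun k => x k - y k).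
  by apply/funext => k; rewrite mulN1r addrC.
by move=> ->; apply/funext => k; rewrite mulN1r addrC.
Qed.

Lemma dual_comb (f : (nat -> R) -> R) n (a : nat -> R) (z : nat -> nat -> R) :
  is_dual w f -> (forall i, in_d w (z i)) ->
  f (comb n a z) = \sum_(i < n) a i * f (z i).
Proof.
move=> fd zd; elim: n => [|n IH]; first by rewrite comb0 big_ord0 dual0.
by rewrite combS (fd.1 _ _ _ (zd n) (in_d_comb n a zd)) IH big_ord_recr /= addrC.
Qed.

Lemma bounded_op_comb T n (a : nat -> R) (z : nat -> nat -> R) :
  bounded_op w T -> (forall i, in_d w (z i)) ->
  T (comb n a z) = comb n a (fun i => T (z i)).
Proof.
move=> bT zd; elim: n => [|n IH]; first by rewrite !comb0 bounded_op0.
by have [_ Tlin _] := bT; rewrite !combS (Tlin _ _ _ (zd n) (in_d_comb n a zd)) IH.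
Qed.

Lemma dual_coord k : is_dual w (fun x => x k).
Proof.
split=> //; exists 1 => x xd; rewrite mul1e nrmE// lee_fin.
exact: coord_le_nrm.
Qed.

(** In the topology of [subspace] every point outside [in_d] is isolated, so the closure adds none
    of them. *)
Lemma closure_in_d (A : set (nat -> R)) (p : weak_d w) :
  A `<=` in_d w -> @closure (weak_d w) A p -> in_d w p.
Proof.
move=> Ad clp; apply: contrapT => pd.
have : nbhs p [set p] by rewrite /nbhs /= -nbhs_subspace_out.
by move=> /clp [q [/Ad qd qp]]; apply: pd; rewrite -qp.
Qed.

(** * Weakly compact operators are strictly singular *)

Lemma weakly_compact_strictly_singular T : bounded_op w T ->
  weakly_compact w T -> strictly_singular w T.
Proof.
move=> bT wcT Y [Yd Y0 Ylin _] Yinf [c c0 Tc].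
have [Td Tlin _] := bT.
have Tn y : Y y -> c * nrm y <= nrm (T y).
  by move=> Yy; rewrite -lee_fin EFinM -!nrmE ?Tc//; [exact/Td/Yd|exact: Yd].
(* Each coordinate of [T y] is one more linear functional, and passing to its kernel keeps the
   dimension infinite. *)
have Yker N : infinite_dim [set y | Y y /\ forall k, (k < N)%N -> T y k = 0].
  elim: N => [|N IH].
    by move=> s; have [y Yy ys] := Yinf s; exists y.
  have := @infinite_dim_ker _ (fun y => T y N) _ _ _ IH.
  move=> H s; have [|||y [[Yy yN] TyN] ys] := H _ _ _ s.
  - by split=> // k _; rewrite (bounded_op0 bT).
  - move=> a x y [Yx xN] [Yy yN]; split; first exact: Ylin.
    move=> k kN; rewrite Tlin; [|exact: Yd|exact: Yd].
    by rewrite xN// yN// mulr0 addr0.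
  - by move=> a x y [/Yd xd _] [/Yd yd _]; rewrite Tlin.
  exists y => //; split=> // k; rewrite ltnS leq_eqVlt => /orP[/eqP -> //|].
  exact: yN.
have [|||N|g gd [z zP]] := @escaping_sequence (T @` Y).
- by move=> _ [y /Yd yd <-]; exact: Td.
- by exists (fun=> 0); rewrite ?(bounded_op0 bT).
- move=> a _ _ [x Yx <-] [y Yy <-]; exists (fun k => a * x k + y k).
    exact: Ylin.
  by rewrite Tlin//; exact: Yd.
- have [y [Yy yN] y0] := Yker N [::]; exists (T y); first by exists y.
  split=> // Ty0; have := Tn y Yy; rewrite Ty0 nrm0 leNgt mulr_gt0//.
  apply: nrm_gt0; first exact: Yd.
  move=> yE; apply: (y0 (fun=> 0)); rewrite yE.
  by apply/funext => k; rewrite big_ord0.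
(* The factor [c] brings preimages into the unit ball: if [T y = z n] then
   [c * nrm y <= nrm (z n) <= 1]. *)
pose u n : weak_d w := fun k => c * z n k.
have zd n : in_d w (z n) by have [[y /Yd yd <-] _ _ _] := zP n; exact: Td.
have uA n : (T @` unit_ball w) (u n).
  have [[y Yy yz] z1 _ _] := zP n; exists (fun k => c * y k).
    apply/unit_ballP; split; first exact/in_dZ/Yd.
    rewrite (le_trans (nrmZ c (Yd _ Yy)))// gtr0_norm//.
    by rewrite (le_trans (Tn _ Yy))// yz.
  by rewrite (bounded_opZ c bT (Yd _ Yy)) yz.
have [|p [Kp clp]] := wcT (u @ \oo) _.
  by exists 0%N => // n _; apply: subset_closure.
have pd : in_d w p.
  by apply: closure_in_d Kp => _ [x [xd _] <-]; exact: Td.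
have pf f e m : is_dual w f -> 0 < e ->
    exists2 n, (m <= n)%N & `|f p - f (u n)| < e.
  move=> fd e0; have um : (u @ \oo) [set u n | n in [set n | (m <= n)%N]].
    by exists m => // n /= mn; exists n.
  have [_ [[n mn <-] pn]] := clp _ _ um (nbhs_weak_d pd fd e0).
  by exists n.
(* Coordinate [k] of [u n] is 0 once [n > k], so the cluster point is 0; this contradicts
   [g (u n) >= c / 8]. *)
have p0 : p = (fun=> 0).
  apply/funext => k; apply/eqP; rewrite -normr_le0 leNgt; apply/negP => pk.
  have [n kn] := pf _ _ k.+1 (dual_coord k) pk.
  have [_ _ _ zn] := zP n; rewrite /u zn// mulr0 subr0 ltxx//.
have [|n _] := pf g (c / 8) 0%N gd; first by rewrite divr_gt0.
have [_ _ gz _] := zP n.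
rewrite p0 (dual0 gd) (dualZ c gd (zd n)) sub0r normrN.
rewrite ger0_norm; last by rewrite mulr_ge0 ?(ltW c0)// (le_trans _ gz)// divr_ge0.
by rewrite ltr_pM2l// ltNge -div1r gz.
Qed.

(** * Block sequences *)

(* Blocks with disjoint supports may have their signs changed freely, so a
   functional bounded away from 0 on them forces a lower l^1 estimate. *)
Lemma blocks_lower (f : (nat -> R) -> R) (u : nat -> nat -> R) (C d : R) :
  is_dual w f -> (forall x, in_d w x -> `|f x| <= C * nrm x) -> 0 <= C ->
  (forall i, in_d w (u i)) ->
  (forall i j k, i != j -> u i k = 0 \/ u j k = 0) ->
  (forall i, d <= `|f (u i)|) ->
  forall n (a : nat -> R), d * \sum_(i < n) `|a i| <= C * nrm (comb n a u).
Proof.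
move=> fd fC C0 ud disj df n a.
pose b i := `|a i| * Num.sg (f (u i)).
have combE (c : nat -> R) k i : (i < n)%N -> u i k != 0 ->
    comb n c u k = c i * u i k.
  move=> ilt uik; rewrite /comb (bigD1 (Ordinal ilt))//= big1 ?addr0// => j ji.
  have ji' : (j : nat) != i by [].
  by have [->|uik0] := disj _ _ k ji'; [rewrite mulr0|rewrite uik0 eqxx in uik].
have [_ ba] : in_d w (comb n b u) /\ nrm (comb n b u) <= nrm (comb n a u).
  apply: in_d_le; first exact: in_d_comb.
  move=> k; have [[i ilt uik]|H] := pselect (exists2 i, (i < n)%N & u i k != 0).
    rewrite !(combE _ _ i)// !normrM normr_id ler_wpM2r// ler_piMr//.
    by rewrite normr_sg lern1 leq_b1.
  rewrite {1}/comb big1 ?normr0// => i _.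
  have [->|ui] := eqVneq (u i k) 0; first by rewrite mulr0.
  by case: H; exists i.
apply: le_trans (_ : f (comb n b u) <= _).
  rewrite dual_comb// mulr_sumr; apply: ler_sum => i _.
  by rewrite /b -mulrA -normrEsg [d * _]mulrC ler_wpM2l.
apply: le_trans (ler_norm _) (le_trans (fC _ (in_d_comb n b ud)) _).
by rewrite ler_wpM2l.
Qed.

Definition block N M x k : R := if (N <= k < M)%N then x k else 0.

Lemma in_d_block N M x : in_d w x -> in_d w (block N M x).
Proof.
move=> xd; have [] // := @in_d_le (block N M x) x xd.
by move=> k; rewrite /block; case: ifP => // _; rewrite normr0.
Qed.

(** The fewer than [N.+1] head entries cost at most [N%:R * d], the tail beyond [M] at most [e / 2],
    and the block removes everything between. *)
Lemma block_approx x (e d : R) N : in_d w x -> 0 < e ->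
  N%:R * d <= e / 2 -> 0 <= d -> (forall k, (k < N)%N -> `|x k| <= d) ->
  exists2 M, (N < M)%N & nrm (fun k => x k - block N M x k) <= e.
Proof.
move=> xd e0 Nd d0 xN.
have [|M HM] := @tail_small x (e / 2) xd; first by rewrite divr_gt0.
exists (maxn N.+1 M); first by rewrite leq_max leqnn.
set M' := maxn N.+1 M; apply: nrm_le; first exact/in_dB/in_d_block.
move=> s us; apply: le_trans (wsum_filter 0 s _ (fun k => (k < N)%N)) _.
set s1 := [seq k <- s | (k < N)%N]; set s2 := [seq k <- s | _].
have us2 : uniq s2 by exact: filter_uniq.
have s1e : wsum 0 s1 (fun k => x k - block N M' x k) <= e / 2.
  apply: le_trans Nd; apply: (@le_trans _ _ ((size s1)%:R * d)).
    apply: wsum_le_const => // k; rewrite mem_filter => /andP[kN _].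
    by rewrite /block leqNgt kN /= subr0 xN.
  rewrite ler_wpM2r// ler_nat -[leqRHS](size_iota 0).
  apply: uniq_leq_size; first exact: filter_uniq.
  by move=> k; rewrite mem_filter mem_iota add0n => /andP[].
have s2e : wsum 0 s2 (fun k => x k - block N M' x k) <= e / 2.
  apply: le_trans (wsum_filter 0 s2 _ (fun k => (M' <= k)%N)) _.
  set s3 := [seq k <- s2 | (M' <= k)%N].
  rewrite [X in _ + X](_ : _ = 0) ?addr0.
    apply: (@le_trans _ _ (wsum 0 s3 x)).
      apply: wsum_le => k; rewrite mem_filter => /andP[Mk _].
      by rewrite /block (ltnNge k) Mk andbF subr0.
    apply: HM; first exact: filter_uniq.
    by move=> k; rewrite mem_filter geq_max => /andP[/andP[]].
  apply/eqP; rewrite eq_le wsum_ge0 andbT.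
  apply: le_trans (wsum_le_const (lexx 0) _) _; last by rewrite mulr0.
  move=> k; rewrite !mem_filter -ltnNge -leqNgt => /and3P[kM Nk _].
  by rewrite /block Nk kM subrr normr0.
lra.
Qed.

Lemma comb_widen n m (a : nat -> R) (z : nat -> nat -> R) : (n <= m)%N ->
  comb n a z = comb m (fun i => if (i < n)%N then a i else 0) z.
Proof.
move=> nm; apply/funext => k; rewrite /comb.
rewrite (big_ord_widen m (fun i => a i * z i k))// big_mkcond /=.
by apply: eq_bigr => i _; case: ifP => // _; rewrite mul0r.
Qed.

Lemma comb_lin n (c : R) (a b : nat -> R) (z : nat -> nat -> R) :
  (fun k => c * comb n a z k + comb n b z k) = comb n (fun i => c * a i + b i) z.
Proof.
apply/funext => k; rewrite /comb mulr_sumr -big_split /=.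
by apply: eq_bigr => i _; ring.
Qed.

Lemma comb_delta i (z : nat -> nat -> R) : comb i.+1 (fun j => (j == i)%:R) z = z i.
Proof.
apply/funext => k; rewrite /comb big_ord_recr /= eqxx mul1r big1 ?add0r// => j _.
by rewrite ltn_eqF ?mul0r.
Qed.

(** * Closed spans of sequences *)

Section ClosedSpan.
Variable z : nat -> nat -> R.
Hypothesis zd : forall i, in_d w (z i).

Definition closed_span : set (nat -> R) := [set x | in_d w x /\
  forall e, 0 < e -> exists n a, nrm (fun k => x k - comb n a z k) <= e].

Lemma comb_closed_span n (a : nat -> R) : closed_span (comb n a z).
Proof.
split=> [|e e0]; first exact: in_d_comb.
exists n, a; rewrite (_ : (fun k => _) = fun=> 0) ?nrm0 ?ltW//.
by apply/funext => k; rewrite subrr.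
Qed.

Lemma closed_span_subspace : closed_subspace w closed_span.
Proof.
split.
- by move=> x [].
- by rewrite -(comb0 (fun=> 0) z); exact: comb_closed_span.
- move=> a x y [xd Hx] [yd Hy]; split=> [|e e0]; first exact: in_d_lin.
  pose d := e / (`|a| + 1); have a1 : 0 < `|a| + 1 by rewrite ltr_pwDr.
  have d0 : 0 < d by rewrite divr_gt0.
  have de : (`|a| + 1) * d = e by rewrite mulrC divfK ?gt_eqF.
  have [n [b Hb]] := Hx _ d0; have [m [b' Hb']] := Hy _ d0.
  exists (maxn n m), (fun i => a * (if (i < n)%N then b i else 0)
    + if (i < m)%N then b' i else 0); rewrite -comb_lin.
  rewrite -(comb_widen b z (leq_maxl n m)) -(comb_widen b' z (leq_maxr n m)).
  rewrite (_ : (fun k => _) = fun k => a * (x k - comb n b z k)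
    + (y k - comb m b' z k)); last by apply/funext => k; ring.
  have xb := in_dB xd (in_d_comb n b zd); have yb := in_dB yd (in_d_comb m b' zd).
  apply: le_trans (nrm_lin a xb yb) _.
  by rewrite -de mulrDl mul1r lerD ?ler_wpM2l.
- move=> u x uY xd ux; split=> // e e0; have e2 : 0 < e / 2 by rewrite divr_gt0.
  have /fine_cvgP [_ /cvgrPdist_le /(_ _ e2) [n _ /(_ n (leqnn n))]] := ux.
  rewrite /= sub0r normrN => nx.
  have {nx} nx := le_trans (ler_norm _) nx.
  have [un Hu] := uY n; have [m [a Ha]] := Hu _ e2.
  exists m, a; rewrite (_ : (fun k => _) = fun k => 1 * (x k - u n k)
    + (u n k - comb m a z k)); last by apply/funext => k; ring.
  apply: le_trans (nrm_lin 1 (in_dB xd un) (in_dB un (in_d_comb m a zd))) _.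
  rewrite normr1 mul1r nrm_subC.
  have : nrm (fun k => u n k - x k) <= e / 2 by exact: nx.
  lra.
Qed.

(** Since [T] is bounded, the lower estimate passes from combinations to their limits with the same
    [c]. *)
Lemma closed_span_iso T (c : R) : bounded_op w T -> 0 < c ->
  (forall n a, c * nrm (comb n a z) <= nrm (T (comb n a z))) ->
  iso_on w T closed_span.
Proof.
move=> bT c0 H; exists c => // y [yd Hy]; have [Td _ _] := bT.
have [C C0 TC] := bounded_op_nrm bT.
rewrite (nrmE yd) (nrmE (Td _ yd)) -EFinM lee_fin.
(* An approximation within [d] costs [c * d] for [y] and [C * d] for [T y], which add up to [e]. *)
apply/ler_addgt0Pr => e e0; pose d := e / (c + C).
have cC : 0 < c + C by rewrite addr_gt0.
have [|n [a Ha]] := Hy d; first by rewrite divr_gt0.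
have de : (c + C) * d = e by rewrite mulrC divfK ?gt_eqF.
have cd := in_d_comb n a zd; have := H n a.
have := nrm_le_dist yd cd; have := nrm_le_dist (Td _ cd) (Td _ yd).
rewrite -(bounded_opB bT cd yd) => H1 H2 H3.
have := TC _ (in_dB cd yd); rewrite nrm_subC => H4.
have : c * nrm y <= c * (nrm (fun k => y k - comb n a z k) + nrm (comb n a z)).
  by rewrite ler_pM2l.
have : c * nrm (fun k => y k - comb n a z k) <= c * d by rewrite ler_pM2l.
have : C * nrm (fun k => y k - comb n a z k) <= C * d by rewrite ler_pM2l.
move: de; lra.
Qed.

End ClosedSpan.

(** A gliding hump: vectors [T x - y] that are small on ever longer initial segments are close to
    disjoint blocks, on which [f] forces a lower l^1 estimate. *)
Lemma far_images_not_singular T y (f : (nat -> R) -> R) (d : R) :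
  bounded_op w T -> in_d w y -> is_dual w f -> 0 < d ->
  (forall N e, 0 < e -> exists x, [/\ in_d w x, nrm x <= 1,
     d <= `|f (fun k => T x k - y k)| &
     forall k, (k < N)%N -> `|T x k - y k| <= e]) ->
  ~ strictly_singular w T.
Proof.
move=> bT yd fd d0 H; have [Td _ _] := bT.
have [C C0 fC] := dual_nrm fd.
(* With [d = 4 * C * e], passing to blocks leaves [3 * C * e] for [f], hence the l^1 constant
   [3 * e] for the blocks, and returning from blocks to the vectors leaves [2 * e]. *)
pose e := d / (4 * C); have e0 : 0 < e by rewrite divr_gt0// mulr_gt0.
have Ce : 4 * (C * e) = d by rewrite mulrA mulrC divfK// gt_eqF// mulr_gt0.
pose diff x k := T x k - y k.
pose P N (r : (nat -> R) * nat) := [/\ in_d w r.1, nrm r.1 <= 1,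
  d <= `|f (diff r.1)|, (N < r.2)%N &
  nrm (fun k => diff r.1 k - block N r.2 (diff r.1) k) <= e].
have /choice [step stepP] : forall N, exists r, P N r.
  move=> N; pose h := e / 2 / N.+1%:R.
  have h0 : 0 < h by do 2?apply: divr_gt0.
  have hN : N.+1%:R * h = e / 2 by rewrite /h mulrC divfK.
  have [x [xd x1 fx xN]] := H N h h0.
  have [|M NM xM] := block_approx (in_dB (Td x xd) yd) e0 _ (ltW h0) xN.
    by rewrite -hN ler_wpM2r ?(ltW h0)// ler_nat leqnSn.
  by exists (x, M).
pose N := fix N n := if n is m.+1 then (step (N m)).2 else 0%N.
pose x n := (step (N n)).1; pose v n := diff (x n).
pose u n := block (N n) (N n.+1) (v n).
have NS n : (N n < N n.+1)%N by have [] := stepP (N n).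
have Nm := homo_leq leqnn leq_trans (fun n => ltnW (NS n)).
have xd n : in_d w (x n) by have [] := stepP (N n).
have x1 n : nrm (x n) <= 1 by have [] := stepP (N n).
have vd n : in_d w (v n) by apply: in_dB => //; exact: Td.
have ud n : in_d w (u n) by exact: in_d_block.
have vu n : nrm (fun k => v n k - u n k) <= e by have [] := stepP (N n).
have vud n : in_d w (fun k => v n k - u n k) by exact: in_dB.
have disj i j k : i != j -> u i k = 0 \/ u j k = 0.
  wlog ij : i j / (i < j)%N => [wl|_].
    rewrite neq_ltn => /orP[ij|ji]; first by apply: wl => //; rewrite ltn_eqF.
    by apply/or_comm/wl => //; rewrite ltn_eqF.
  rewrite /u /block; case: ifP => [/andP[_ ki]|_]; [right|by left].
  by rewrite ifF// leqNgt (leq_trans ki)// Nm.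
have fu n : 3 * (C * e) <= `|f (u n)|.
  have [_ _ fv _ _] := stepP (N n).
  have := fC _ (vud n); rewrite (dualB fd)// => fvu.
  have : C * nrm (fun k => v n k - u n k) <= C * e by rewrite ler_pM2l.
  have := ler_distD (f (u n)) (f (v n)) 0; rewrite !subr0.
  rewrite -/(x n) -/(v n) in fv; lra.
have lower_v n (b : nat -> R) : 2 * e * \sum_(i < n) `|b i| <= nrm (comb n b v).
  set S := \sum_(i < n) _.
  have H1 : 3 * e * S <= nrm (comb n b u).
    have := blocks_lower fd fC (ltW C0) ud disj fu n b; rewrite -/S => H1.
    by rewrite -(ler_pM2l C0); lra.
  have H2 := nrm_le_dist (in_d_comb n b ud) (in_d_comb n b vd).
  have H3 : nrm (fun k => comb n b v k - comb n b u k) <= e * S.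
    rewrite (_ : (fun k => _) = comb n b (fun i k => v i k - u i k)).
      exact: nrm_comb.
    apply/funext => k; rewrite /comb -sumrB; apply: eq_bigr => i _; ring.
  rewrite nrm_subC in H2; lra.
(* Subtracting [x 0] cancels [y]: the image of [z i] is [v i.+1 - v 0]. *)
pose z i k := x i.+1 k - x 0%N k.
have zd i : in_d w (z i) by exact: in_dB.
have z2 i : nrm (z i) <= 2.
  by rewrite (le_trans (nrmB _ _))// (le_trans (lerD (x1 _) (x1 _))).
have lower_z n (a : nat -> R) : 2 * e * \sum_(i < n) `|a i| <= nrm (T (comb n a z)).
  pose b i := if i is j.+1 then a j else - \sum_(i < n) a i.
  have -> : T (comb n a z) = comb n.+1 b v.
    rewrite bounded_op_comb//; apply/funext => k; rewrite /comb big_ord_recl /=.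
    rewrite mulNr mulr_suml addrC -sumrB; apply: eq_bigr => i _.
    rewrite /z (bounded_opB bT)// /v /diff; ring.
  apply: le_trans (lower_v _ _); rewrite big_ord_recl /= ler_wpM2l ?lerDr//.
  by rewrite mulr_ge0// ltW.
move=> ssT; apply: (ssT (closed_span z)).
- exact: closed_span_subspace.
- apply: (@infinite_dim_free _ z) => [i|n a az i ilt].
    by rewrite -(comb_delta i z); exact: comb_closed_span.
  have := lower_z n a; rewrite az (bounded_op0 bT) nrm0 => le0.
  have e2 : 0 < 2 * e by rewrite mulr_gt0.
  apply/eqP; rewrite -normr_le0 -(ler_pM2l e2) mulr0.
  apply: le_trans le0; rewrite ler_pM2l//.
  by rewrite (bigD1 (Ordinal ilt))//= lerDl sumr_ge0.
(* The norm of [comb n a z] is at most twice the sum of the [|a i|], so [lower_z] bounds [T] below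
   by [e]. *)
- apply: (closed_span_iso zd bT e0) => n a; apply: le_trans (lower_z n a).
  have := nrm_comb n a zd z2.
  rewrite -(ler_pM2l e0); lra.
Qed.

(** * Strictly singular operators are weakly compact *)

Lemma closure_weak_approx (A : set (nat -> R)) (p : weak_d w) f N (e : R) :
  A `<=` in_d w -> @closure (weak_d w) A p -> is_dual w f -> 0 < e ->
  exists a, [/\ A a, `|f p - f a| < e & forall k, (k < N)%N -> `|p k - a k| < e].
Proof.
move=> Ad clp fd e0; have pd := closure_in_d Ad clp.
have HN : nbhs p [set q : weak_d w | forall k, (k < N)%N -> `|p k - q k| < e].
  elim: N => [|N IH]; first exact: filterS filterT.
  apply: filterS2 IH (nbhs_weak_d pd (dual_coord N) e0) => q qN qe k.
  by rewrite ltnS leq_eqVlt => /orP[/eqP ->|/qN].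
have [a [Aa [fa aN]]] := clp _ (filterI (nbhs_weak_d pd fd e0) HN).
by exists a.
Qed.

Lemma strictly_singular_weakly_compact T : bounded_op w T ->
  strictly_singular w T -> weakly_compact w T.
Proof.
move=> bT ssT; have [Td _ _] := bT; have [C C0 TC] := bounded_op_nrm bT.
set A := T @` unit_ball w.
have Ad : A `<=` in_d w by move=> _ [x [xd _] <-]; exact: Td.
have AC a : A a -> nrm a <= C.
  move=> [x /unit_ballP [xd x1] <-]; rewrite (le_trans (TC x xd))//.
  by rewrite ler_piMr// ltW.
rewrite /weakly_compact /rel_weakly_compact -/A.
set K := closure _; rewrite compact_ultra => F FU FK.
have FP : ProperFilter F by exact: ultra_proper.
have Kd : K `<=` in_d w by move=> p; exact: closure_in_d.
(* Points of [K] have coordinates within 1 of those of [A], hence in a compact segment; the image of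
   [F] clusters there, and for an ultrafilter a cluster point is a limit. *)
have /choice [y yP] : forall k, exists r : R,
    forall e, 0 < e -> F [set q : weak_d w | `|r - q k| < e].
  move=> k; have := @segment_compact R (- (C + 1)) (C + 1).
  move=> /(_ ((fun q : weak_d w => q k) @ F) _) [|r [_ clr]].
    apply: (@filterS _ F _ _ _ _ FK) => p Kp.
    have [a [Aa pa _]] := closure_weak_approx 0 Ad Kp (dual_coord k) ltr01.
    have := coord_le_nrm k (Ad _ Aa); have := AC a Aa.
    have := ler_distD (a k) (p k) 0; rewrite !subr0 => H1 H2 H3.
    rewrite /= in_itv /= -ler_norml; lra.
  exists r => e e0.
  have [//|Fr] := in_ultra_setVsetC [set q : weak_d w | `|r - q k| < e] FU.
  have [t [/= rt tr]] := clr [set t | ~ `|r - t| < e] _ Fr (nbhsx_ballx r e e0).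
  by case: rt.
have yN N e : 0 < e ->
    F [set q : weak_d w | forall k, (k < N)%N -> `|y k - q k| < e].
  move=> e0; elim: N => [|N IH]; first exact: filterS filterT.
  apply: filterS2 IH (yP N e e0) => q qN qe k.
  by rewrite ltnS leq_eqVlt => /orP[/eqP ->|/qN].
(* Members of [K] are only weakly adherent to [A]; this replaces one by an actual image, controlling
   [f] and finitely many coordinates. *)
have yA S f N e : F S -> is_dual w f -> 0 < e -> exists q a,
    [/\ S q, A a, `|f q - f a| < e & forall k, (k < N)%N -> `|y k - a k| <= e].
  move=> FS fd e0; have e2 : 0 < e / 2 by rewrite divr_gt0.
  have [q [[Sq Kq] qN]] := filter_ex (filterI (filterI FS FK) (yN N _ e2)).
  have [a [Aa fa aN]] := closure_weak_approx N Ad Kq fd e2.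
  exists q, a; split=> //; first lra.
  move=> k kN; have := ler_distD (q k) (y k) (a k).
  have := qN k kN; have := aN k kN; lra.
have yd : in_d w y.
  (* On [s] some [a] in [A] agrees with [y] up to [1 / (size s).+1], so its weighted sum, at most
     [C], is exceeded by at most 1. *)
  apply: (@wsum_bounded_in_d _ (1 + C)) => s us; have [N HN] := seq_bound s.
  pose e : R := (size s).+1%:R^-1.
  have [|q [a [_ Aa _ aN]]] := yA setT _ N e filterT (dual_coord 0).
    by rewrite invr_gt0.
  have -> : y = fun k => 1 * (y k - a k) + a k by apply/funext => k; ring.
  rewrite (le_trans (wsumD _ _ _ _ _))// normr1 mul1r; apply: lerD; last first.
    by rewrite (le_trans (wsum_le_nrm _ us)) ?AC//; exact: Ad.
  apply: le_trans (wsum_le_const (e := e) _ _) _; first by rewrite invr_ge0.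
    by move=> k /HN /aN.
  by rewrite ler_pdivrMr// mul1r ler_nat.
have Fy : F --> (y : weak_d w).
  apply: cvg_weak_d => //; first exact: filterS Kd FK.
  move=> f fd e e0.
  have [//|FC] := in_ultra_setVsetC [set q : weak_d w | `|f y - f q| < e] FU.
  (* Otherwise [F] contains the points [q] with [|f y - f q| >= e]; exchanging such a [q] for some
     [T x] loses less than [e / 2]. *)
  case: (@far_images_not_singular T y f (e / 2) bT yd fd _ _ ssT).
    by rewrite divr_gt0.
  move=> N h h0; have mh : 0 < Num.min h (e / 2).
    by rewrite lt_min h0 divr_gt0.
  have [q [a [/negP + [x /unit_ballP [xd x1] <-] fqa aN]]] := yA _ _ N _ FC fd mh.
  rewrite -leNgt => fyq; move: fqa aN; rewrite lt_min => /andP[_ fqa] aN.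
  exists x; split=> //.
    rewrite (dualB fd)//; last exact: Td.
    have := ler_distD (f (T x)) (f y) (f q); rewrite distrC (distrC (f y)).
    rewrite (distrC (f (T x)) (f q)) distrC in fyq *; lra.
  by move=> k kN; rewrite distrC (le_trans (aN k kN))// ge_min lexx.
exists y; split=> //; apply: closed_closure => B By.
exact: filter_ex (filterI FK (Fy _ By)).
Qed.

End LorentzSpace.

Theorem theorem3p6 (R : realType) (w : nat -> R)
  (hw0 : w 0%N = 1)
  (hwdec : forall n, w n.+1 <= w n)
  (hwlim : w @ \oo --> (0 : R))
  (hwsum : (\sum_(0 <= n <oo) (w n)%:E = +oo)%E)
  (T : (nat -> R) -> (nat -> R))
  (hT : bounded_op w T) :
  weakly_compact w T <-> strictly_singular w T.
Proof.
split.
- exact: weakly_compact_strictly_singular.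
- exact: strictly_singular_weakly_compact.
Qed.
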